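(* Let $n\ge 2$ and $k\ge 1$ be integers. Let $$R_{1}=\{a\in(\mathbb{Z}/n\mathbb{Z})^\times:\left(\tfrac{a}{n}\right)_k=1\},\qquad R_{-1}=\{a\in(\mathbb{Z}/n\mathbb{Z})^\times:\left(\tfrac{a}{n}\right)_k=-1\}.$$ If both $R_1$ and $R_{-1}$ are nonempty, then $$\sum_{a\bmod n}\left(\frac{a}{n}\right)_k=0,$$ where the sum runs over a complete residue system modulo $n$.
   Context: For integers $n\ge 2$, $k\ge 1$ and $a\in\mathbb{Z}$, the exponential congruence symbol $\left(\frac{a}{n}\right)_k\in\{-1,0,1\}$ is defined to be $1$ if $a^k\equiv 1\pmod n$, $-1$ if $a^k\equiv -1\pmod n$, and $0$ otherwise. The cases are read in order, the first applicable one being used; this matters only for $n=2$. The symbol depends only on the residue class of $a$ modulo $n$, so it is also regarded as a function on $\mathbb{Z}/n\mathbb{Z}$. *)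

(* Defs.v *)
From mathcomp Require Import all_boot all_order all_algebra.

Set Implicit Arguments.
Unset Strict Implicit.
Unset Printing Implicit Defensive.

Import Order.TTheory GRing.Theory Num.Theory.
Local Open Scope ring_scope.

(* The exponential congruence symbol (a / n)_k; the order of the tests only
   matters for n = 2, where 1 and -1 coincide. *)
Definition expsym (n k : nat) (a : int) : int :=
  if (a ^+ k == 1 %[mod n])%Z then 1
  else if (a ^+ k == -1 %[mod n])%Z then -1
  else 0.

Lemma expsym_mod (n k : nat) (a b : int) :
  (a = b %[mod n])%Z -> expsym n k a = expsym n k b.
Proof. by move=> eq_ab; rewrite /expsym -modzXm eq_ab modzXm. Qed.

(* The symbol as a function on Z/nZ, evaluated at the representative in
   {0, ..., n - 1}, which expsym_mod makes immaterial. Only meaningful for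
   1 < n, since 'Z_0 and 'Z_1 both denote Z/2Z. *)
Definition expsymZ (n k : nat) (x : 'Z_n) : int := expsym n k (x : nat)%:Z.

(* The set R_e of units of Z/nZ at which the symbol takes the value e. *)
Definition expsym_units (n k : nat) (e : int) : {set {unit 'Z_n}} :=
  [set u | expsymZ k (val u) == e].

(* Every integer is congruent to exactly one entry of s, counted with
   multiplicity. *)
Definition complete_residue_system (n : nat) (s : seq int) : Prop :=
  forall a : int, count (fun r => (r == a %[mod n])%Z) s = 1%N.

(* Main.v *)
Require Import Defs.
From mathcomp Require Import all_boot all_order all_algebra.
From mathcomp Require Import ring.

Import Order.TTheory GRing.Theory Num.Theory.
Local Open Scope ring_scope.

(** If b has symbol -1, then b ^ k = -1 <> 1 mod n, so multiplication by b
    permutes the residue classes and negates the symbol. The sum therefore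
    equals its own opposite. *)

(** Permuting the classes means that [[seq b * r | r <- s]] is again a complete residue system
    ([complete_residue_system_mull]), which leaves the sum unchanged
    ([eq_sum_complete_residue_system]); the sign change is [expsym_mulN1]. *)

Lemma sum_periodic_count (n : nat) (s : seq int) (f : int -> int) (a : int) :
    (forall x y : int, (x = y %[mod n])%Z -> f x = f y) ->
  \sum_(r <- s | (r == a %[mod n])%Z) f r =
    f a *+ count (fun r => (r == a %[mod n])%Z) s.
Proof.
move=> fP; rewrite (eq_bigr (fun=> f a)); last by move=> r /eqP /fP.
by rewrite big_const_seq iter_addr addr0.
Qed.

(** Double counting over the congruent pairs in [s] and [t]: each entry of either list has exactly
    one partner in the other. *)
Lemma eq_sum_complete_residue_system (n : nat) (s t : seq int)
    (f : int -> int) :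
    (forall x y : int, (x = y %[mod n])%Z -> f x = f y) ->
    complete_residue_system n s -> complete_residue_system n t ->
  \sum_(a <- s) f a = \sum_(a <- t) f a.
Proof.
move=> fP hs ht.
transitivity (\sum_(a <- s) \sum_(b <- t | (b == a %[mod n])%Z) f b).
  by apply: eq_bigr => a _; rewrite sum_periodic_count // ht.
rewrite (exchange_big_dep predT) //=; apply: eq_bigr => b _.
transitivity (\sum_(a <- s | (a == b %[mod n])%Z) f a).
  by apply: eq_big => [a|a /eqP /fP] //; rewrite eq_sym.
by rewrite sum_periodic_count // hs.
Qed.

(** As [c] inverts [b], [b * r] is congruent to [a] exactly when [r] is congruent to [c * a]. *)
Lemma complete_residue_system_mull (n : nat) (s : seq int) (b c : int) :
    (b * c = 1 %[mod n])%Z -> complete_residue_system n s ->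
  complete_residue_system n [seq b * r | r <- s].
Proof.
move=> /eqP bc1 hs a; rewrite count_map -[RHS](hs (c * a)).
apply: eq_count => r /=; move: bc1; rewrite !eqz_mod_dvd => bc1.
apply/idP/idP => h.
  have -> : r - c * a = c * (b * r - a) - r * (b * c - 1) by ring.
  by rewrite rpredB // dvdz_mull.
have -> : b * r - a = b * (r - c * a) + a * (b * c - 1) by ring.
by rewrite rpredD // dvdz_mull.
Qed.

(** The value -1 is reached only after the test against 1 has failed, so 1 and -1 are distinct
    modulo [n]. *)
Lemma expsym_eqN1 (n k : nat) (b : int) :
  expsym n k b = -1 -> (b ^+ k = -1 %[mod n])%Z /\ (1 != -1 %[mod n])%Z.
Proof.
rewrite /expsym; case: ifP => // ne1; case: ifP => // /eqP eqN1 _.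
by split=> //; rewrite eq_sym -eqN1 ne1.
Qed.

Lemma expsym_mulN1 (n k : nat) (b a : int) :
  expsym n k b = -1 -> expsym n k (b * a) = - expsym n k a.
Proof.
move=> /expsym_eqN1 [bk ne].
have mulE : ((b * a) ^+ k = - a ^+ k %[mod n])%Z.
  by rewrite exprMn -modzMml bk modzMml mulN1r.
have modN (x y : int) : (- x == y %[mod n])%Z = (x == - y %[mod n])%Z.
  by rewrite !eqz_mod_dvd -rpredN; congr (_ %| _)%Z; ring.
rewrite /expsym mulE !modN opprK.
(* Negation has swapped the two tests on [a ^+ k]; their order is harmless because 1 and -1 differ
   modulo [n]. *)
case: (eqVneq (a ^+ k %% n)%Z (1 %% n)%Z) => [->|_]; first by rewrite (negPf ne).
by case: ifP; rewrite ?opprK ?oppr0.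
Qed.

Theorem theorem6p2 (n k : nat) (hn : (2 <= n)%N) (hk : (1 <= k)%N)
    (hR1 : expsym_units n k 1 != set0)
    (hRN1 : expsym_units n k (-1) != set0)
    (s : seq int) (hs : complete_residue_system n s) :
  \sum_(a <- s) expsym n k a = 0.
Proof.
have [u] := set0Pn _ hRN1; rewrite inE /expsymZ => /eqP.
set b := Posz _ => hb.
(* The inverse of [b] is read off from [b ^+ k = -1], using [0 < k]. *)
have b_unit : (b * - b ^+ k.-1 = 1 %[mod n])%Z.
  rewrite mulrN -exprS prednK // -modzNm (expsym_eqN1 _ _ _ hb).1.
  by rewrite modzNm opprK.
have sumN : \sum_(a <- s) expsym n k a = - \sum_(a <- s) expsym n k a.
  rewrite {1}(eq_sum_complete_residue_system _ _ _ _ (@expsym_mod n k) hs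
    (complete_residue_system_mull _ _ _ _ b_unit hs)) big_map -sumrN.
  by apply: eq_bigr => a _; apply: expsym_mulN1.
by apply/eqP; rewrite -eqNr -sumN.
Qed.
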